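(* Let $n\ge 1$, $G=GL_n(\mathbb{C})$, $\mathfrak{g}=\mathfrak{gl}_n(\mathbb{C})$, and let $B\subseteq G$ be the Borel subgroup of upper triangular matrices. Let $X\in\mathfrak{g}$ be an element that is not of the form $a\mathbf{1}$ for any $a\in\mathbb{C}$, where $\mathbf{1}$ is the identity matrix. Let $H_1,H_2\subseteq\mathfrak{g}$ be distinct strict Hessenberg spaces. Then $Hess(X,H_1)\neq Hess(X,H_2)$ as subsets of $G/B$.
   Context: Let $\mathfrak{b}$ be the Lie algebra of upper triangular $n\times n$ matrices. A strict Hessenberg space is a linear subspace $H\subseteq\mathfrak{g}$ such that $\mathfrak{b}\subseteq H$ and $[H,\mathfrak{b}]\subseteq H$. For $X\in\mathfrak{g}$ and a Hessenberg space $H$, the Hessenberg variety is $Hess(X,H)=\{gB\in G/B : g^{-1}Xg\in H\}$. *)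

(* Defs.v *)
(* The complex numbers are R[i], for R : realType. *)
From mathcomp Require Import all_boot all_order all_algebra.
From mathcomp Require Import classical_sets reals.
From mathcomp Require Import complex.

Set Implicit Arguments.
Unset Strict Implicit.
Unset Printing Implicit Defensive.

Import GRing.Theory.
Local Open Scope classical_set_scope.
Local Open Scope ring_scope.

Section Hessenberg.
Variables (F : fieldType) (n : nat).
Implicit Types (g X : 'M[F]_n) (H : {vspace 'M[F]_n}).

(* [is_trig_mx] is lower triangularity, hence the transpose. *)
Definition upper_triangular : set 'M[F]_n := [set A | is_trig_mx A^T].

Definition GLset : set 'M[F]_n := [set g | g \in unitmx].

Definition borel_group : set 'M[F]_n := GLset `&` upper_triangular.

Definition lie_bracket (A B : 'M[F]_n) : 'M[F]_n := A *m B - B *m A.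

Definition strict_hessenberg H : Prop :=
  (forall A, upper_triangular A -> A \in H) /\
  (forall A T, A \in H -> upper_triangular T -> lie_bracket A T \in H).

(* The coset g B; a subset of G/B is a set of such cosets. *)
Definition borel_coset g : set 'M[F]_n := [set g *m b | b in borel_group].

Definition Hess X H : set (set 'M[F]_n) :=
  [set borel_coset g | g in [set g | GLset g /\ invmx g *m X *m g \in H]].

End Hessenberg.

(* Main.v *)
(* A strict Hessenberg space is spanned by the upper triangular matrices and
   some matrix units E_pq with p > q.  If E_pq is in H1 but not in H2, then no
   Borel conjugate of an element of H2 has a nonzero (p, q) entry, so it
   suffices to conjugate X to a matrix N of H1 with N p q != 0.  Such an N is
   found by making X triangular except for one nonzero entry at (q + 1, q), and
   then exchanging the indices q + 1 and p.  The almost triangular form is built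
   by induction on n: when n >= 3, a nonscalar X has an eigenvector modulo which
   it is still nonscalar. *)
Require Import Defs.
From mathcomp Require Import all_boot all_order all_fingroup all_algebra.
From mathcomp Require Import boolp classical_sets reals.
From mathcomp Require Import complex spectral zify.

Set Implicit Arguments.
Unset Strict Implicit.
Unset Printing Implicit Defensive.

Import GRing.Theory.
Local Open Scope ring_scope.

(** * Similarity of matrices *)

Definition mx_similar (F : fieldType) (n : nat) (A B : 'M[F]_n) : Prop :=
  exists2 G, G \in unitmx & G *m A = B *m G.

Section Similarity.
Variables (F : fieldType) (n : nat).
Implicit Types A B C : 'M[F]_n.

Lemma mx_similar_refl A : mx_similar A A.
Proof. by exists 1%:M; rewrite ?unitmx1 // mulmx1 mul1mx. Qed.

Lemma mx_similar_sym A B : mx_similar A B -> mx_similar B A.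
Proof.
case=> G uG eG; exists (invmx G); first by rewrite unitmx_inv.
by rewrite -[LHS](mulmxK uG) -(mulmxA (invmx G)) -eG mulKmx.
Qed.

Lemma mx_similar_trans A B C :
  mx_similar A B -> mx_similar B C -> mx_similar A C.
Proof.
move=> [G uG eG] [G' uG' eG']; exists (G' *m G); first by rewrite unitmx_mul uG'.
by rewrite -mulmxA eG !mulmxA eG'.
Qed.

Lemma mx_similar_tr A B : mx_similar A B -> mx_similar A^T B^T.
Proof.
case=> G uG eG; apply: mx_similar_sym.
by exists G^T; rewrite ?unitmx_tr // -!trmx_mul eG.
Qed.

Lemma mx_similar_perm A (s : 'S_n) :
  mx_similar A (\matrix_(i, j) A (s i) (s j)).
Proof.
exists (perm_mx s); first exact: unitmx_perm.
have -> : \matrix_(i, j) A (s i) (s j) = col_perm s (row_perm s A).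
  by apply/matrixP=> i j; rewrite !mxE.
by rewrite -row_permE col_permE -mulmxA -perm_mxM mulVg perm_mx1 mulmx1.
Qed.

End Similarity.

(** Conjugation by diag(1, [G]) changes only the lower blocks, because the upper right one is 0. *)
Lemma mx_similar_drblock (F : fieldType) (m : nat) (a : 'M[F]_1)
    (c : 'M[F]_(m, 1)) (Y Z : 'M[F]_m) :
  mx_similar Y Z -> exists c', mx_similar (block_mx a 0 c Y) (block_mx a 0 c' Z).
Proof.
case=> G uG eG; exists (G *m c); exists (block_mx 1%:M 0 0 G).
  by rewrite unitmxE det_ublock det1 mul1r -unitmxE.
by rewrite !mulmx_block !(mul1mx, mulmx1, mul0mx, mulmx0, addr0, add0r) eG.
Qed.

(** * Passing to the quotient by an eigenvector *)

(** In a basis of row vectors that starts with a multiple of [v], the block [Y] is the action of [X]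
    on the quotient by the line of [v]. When this action is a scalar [b], the image of [X - b%:M]
    falls into the line. *)
Lemma eigenvector_block {F : fieldType} {m : nat} {X : 'M[F]_(1 + m)}
    {v : 'rV[F]_(1 + m)} {a : F} : v != 0 -> v *m X = a *: v ->
  exists (c : 'M[F]_(m, 1)) (Y : 'M[F]_m),
    mx_similar X (block_mx a%:M 0 c Y) /\
    forall b, Y = b%:M -> (X - b%:M <= v)%MS.
Proof.
move=> v0 vX; pose G := row_ebase v; have uG : G \in unitmx by apply: row_ebase_unit.
(* As [v] has rank 1, it is the first row of the invertible [row_ebase v] up to the nonzero scalar
   in [col_ebase v]. *)
have [k k0 vG] : exists2 k : F, k != 0 & v = k *: usubmx G.
  exists (col_ebase v 0 0).
    have := col_ebase_unit v; rewrite unitmxE det_mx11 unitfE; exact.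
  rewrite -{1}(mulmx_ebase v) rank_rV v0 /=.
  rewrite [col_ebase v]mx11_scalar -mulmxA mul_scalar_mx mxE mulr1n; congr (_ *: _).
  rewrite -/G -{1}[G]vsubmxK (_ : pid_mx 1 = row_mx 1%:M 0 :> 'M_(1, 1 + m)).
    by rewrite mul_row_col mul1mx mul0mx addr0.
  by rewrite pid_mx_row.
pose M := G *m X *m invmx G.
have uM : usubmx M = row_mx a%:M 0.
  have -> : usubmx M = usubmx G *m X *m invmx G.
    by rewrite /M -!mul_usub_mx.
  have -> : usubmx G *m X = a *: usubmx G.
    apply: (can_inj (scalerK k0)).
    by rewrite scalemxAl -vG vX vG !scalerA mulrC.
  rewrite -scalemxAl mul_usub_mx mulmxV // (@scalar_mx_block _ 1 m).
  by rewrite /block_mx col_mxKu scale_row_mx scaler0 scale_scalar_mx mulr1.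
have MG : G *m X = M *m G by rewrite /M mulmxKV.
have eM : M = block_mx a%:M 0 (dlsubmx M) (drsubmx M).
  by rewrite -{1}[M]vsubmxK uM -[dsubmx M]hsubmxK.
exists (dlsubmx M), (drsubmx M); split; first by exists G; rewrite -?eM.
move=> b eY.
have -> : X - b%:M = invmx G *m (M - b%:M) *m G.
  by rewrite mulmxBr mulmxBl -mulmxA -MG mulKmx // scalar_mxC mulmxKV.
(* Only the first column of [M - b%:M] survives, so all its rows are multiples of the first basis
   vector. *)
have -> : M - b%:M = col_mx (a%:M - b%:M) (dlsubmx M) *m row_mx 1%:M 0.
  rewrite {1}eM eY (@scalar_mx_block _ 1 m b) opp_block_mx add_block_mx.
  by rewrite mul_col_row !mulmx1 !mulmx0 !subr0 subrr.
apply: (submx_trans (B := row_mx 1%:M 0 *m G)).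
  by rewrite !mulmxA -mulmxA submxMl.
rewrite -{1}[G]vsubmxK mul_row_col mul1mx mul0mx addr0.
by rewrite vG eqmx_scale.
Qed.

(* If X - b and X - d have their images in the lines of independent eigenvectors
   v and w, then (d - b) 1 has rank at most 2 < 1 + m, so b = d, and the image
   of X - b is in the intersection of the two lines. *)
Lemma nonscalar_quotient (C : numClosedFieldType) (m : nat) (X : 'M[C]_(1 + m)) :
    (1 < m)%N -> ~~ is_scalar_mx X ->
  exists (a : C) (c : 'M[C]_(m, 1)) (Y : 'M[C]_m),
    ~~ is_scalar_mx Y /\ mx_similar X (block_mx a%:M 0 c Y).
Proof.
move=> m1 nX; apply: contrapT => noY.
have scalarQ (v : 'rV_(1 + m)) a : v != 0 -> v *m X = a *: v -> exists b, (X - b%:M <= v)%MS.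
  move=> v0 vX; have [c [Y [sXY hb]]] := eigenvector_block v0 vX.
  case: (boolP (is_scalar_mx Y)) => [/is_scalar_mxP [b eY]|nY].
    by exists b; apply: hb.
  by case: noY; exists a, c, Y.
have [a /eigenvalueP[v vX v0]] := eigenvalue_closed X (ltn0Sn m).
have [b Xb] := scalarQ _ _ v0 vX.
(* The rank of [X - b%:M] is at most 1, so its kernel has dimension at least [m > 1] and exceeds the
   line of [v]. *)
have [w wX nwv] : exists2 w : 'rV_(1 + m), w *m X = b *: w & ~~ (w <= v)%MS.
  have : ~~ (kermx (X - b%:M) <= v)%MS.
    apply: contraL m1 => /mxrankS; rewrite mxrank_ker rank_rV v0 -leqNgt leq_subLR => le_m.
    rewrite -(leq_add2l 1); apply: leq_trans le_m _; rewrite leq_add2r.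
    by have := mxrankS Xb; rewrite rank_rV v0.
  case/row_subPn => i ni; exists (row i (kermx (X - b%:M))) => //.
  apply/eqP; rewrite -subr_eq0 -mul_mx_scalar -mulmxBr; apply/eqP/sub_kermxP.
  exact: row_sub.
have w0 : w != 0 by apply: contraNneq nwv => ->; apply: sub0mx.
have [d Xd] := scalarQ _ _ w0 wX.
have ebd : d = b.
  apply/eqP; rewrite -subr_eq0; apply: contraLR m1 => db.
  have : ((d - b)%:M <= v + w)%MS.
    have -> : (d - b)%:M = (X - b%:M) - (X - d%:M).
      by rewrite opprB [RHS]addrC addrA addrNK raddfB.
    by rewrite addmx_sub_adds // eqmx_opp.
  move/mxrankS; rewrite mxrank_unit => [le|]; last first.
    by rewrite unitmxE det_scalar unitfE expf_neq0.
  rewrite -leqNgt -ltnS; apply: leq_trans le (leq_trans (mxrank_adds_leqif _ _) _).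
  by rewrite !rank_rV v0 w0.
rewrite {d}ebd in Xd.
(* A nonzero [u] in this image spans both the line of [v] and that of [w], which are different. *)
have : X - b%:M != 0.
  apply: contra nX; rewrite subr_eq0 => /eqP ->.
  exact: scalar_mx_is_scalar.
case/rowV0Pn => u uX u0.
have uv := submx_trans uX Xb; have uw := submx_trans uX Xd.
have wu : (w <= u)%MS by rewrite -(geq_leqif (mxrank_leqif_sup uw)) !rank_rV u0 w0.
by rewrite (submx_trans wu uv) in nwv.
Qed.

(** * Almost triangular form *)

(** Transpose of the almost triangular form: splitting off row eigenvectors yields block lower
    triangular matrices. *)
Definition lower_except (F : fieldType) (n q : nat) (N : 'M[F]_n) : Prop :=
  forall i j : 'I_n, (i < j)%N ->
    (N i j != 0) = ((i == q :> nat) && (j == q.+1 :> nat)).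

Lemma is_scalar_mx_tr (F : fieldType) (n : nat) (A : 'M[F]_n) :
  is_scalar_mx A^T = is_scalar_mx A.
Proof.
apply/is_scalar_mxP/is_scalar_mxP => -[a eA]; exists a.
  by rewrite -[A]trmxK eA tr_scalar_mx.
by rewrite eA tr_scalar_mx.
Qed.

(** Base case of the induction: a nonzero off-diagonal entry can be moved to the upper right by a
    swap, and a diagonal [X] has two distinct eigenvalues. *)
Lemma nonscalar_mx2 (F : fieldType) (X : 'M[F]_2) : ~~ is_scalar_mx X ->
  exists N, mx_similar X N /\ lower_except 0 N.
Proof.
move=> nX.
suff [N sXN N01] : exists2 N, mx_similar X N & N ord0 ord_max != 0.
  exists N; split=> // -[[|[|i]] Hi] [[|[|j]] Hj] //= _; rewrite -[RHS]N01.
  by congr (N _ _ != 0); apply: val_inj.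
have [X01|X01] := eqVneq (X ord0 ord_max) 0; last first.
  by exists X; first exact: mx_similar_refl.
have [X10|X10] := eqVneq (X ord_max ord0) 0; last first.
  exists (\matrix_(i, j) X (tperm ord0 ord_max i) (tperm ord0 ord_max j)).
    exact: mx_similar_perm.
  by rewrite mxE tpermL tpermR.
have eX (i j : 'I_2) : i != j -> X i j = 0.
  by case: i j => [[|[|i]] Hi] [[|[|j]] Hj] //= _; [rewrite -[RHS]X01|rewrite -[RHS]X10];
    congr (X _ _); apply: val_inj.
have eX' : X = diag_mx (\row_i X i i).
  apply/matrixP=> i j; rewrite !mxE; have [<-|/eX ->//] := eqVneq i j.
  by rewrite mulr1n.
pose D : 'M[F]_2 := delta_mx ord0 ord_max.
have mulXl : D *m X = X ord_max ord_max *: D.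
  rewrite {1}eX'; apply/matrixP=> i j; rewrite mul_mx_diag !mxE.
  by rewrite mulrC; case: (j =P ord_max) => [->//|]; rewrite andbF !mulr0.
have mulXr : X *m D = X ord0 ord0 *: D.
  rewrite {1}eX'; apply/matrixP=> i j; rewrite mul_diag_mx !mxE.
  by case: (i =P ord0) => [->//|]; rewrite !mulr0.
have DD0 : D *m D = 0 by rewrite mul_delta_mx_0.
(* Conjugating by the unipotent [1%:M + D] creates the difference of the eigenvalues as upper right
   entry. *)
exists (X + (X ord_max ord_max - X ord0 ord0) *: D).
  exists (1%:M + D).
    suff /mulmx1_unit[] : (1%:M + D) *m (1%:M - D) = 1%:M by [].
    by rewrite mulmxDl mul1mx mulmxBr mulmx1 DD0 subr0 subrK.
  rewrite !mulmxDl !mulmxDr mul1mx !mulmx1 -!addrA; congr (_ + _).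
  rewrite mulXl mulXr -scalemxAl DD0 scaler0 addr0 -scalerDl.
  by rewrite addrC subrK.
rewrite !mxE X01 add0r !eqxx mulr1 subr_eq0.
apply: contra nX => /eqP ed; apply/is_scalar_mxP; exists (X ord0 ord0).
apply/matrixP=> i j; rewrite mxE; have [<-|/eX ->//] := eqVneq i j.
case: i => [[|[|i]] Hi] //; rewrite mulr1n; last rewrite -[RHS]ed.
  by congr (X _ _); apply: val_inj.
by congr (X _ _); apply: val_inj.
Qed.

(** Each eigenvector split off with a nonscalar quotient moves the exceptional entry one step down
    the diagonal, so induction on [n] reaches every positive [q]. *)
Lemma nonscalar_lower_except (C : numClosedFieldType) (n q : nat) (X : 'M[C]_n) :
    (q.+1 < n)%N -> ~~ is_scalar_mx X ->
  exists N, mx_similar X N /\ lower_except q N.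
Proof.
have [k] := ubnP n; elim: k => // k IHk in n q X *; rewrite ltnS => le_nk.
(* Stated for any matrix because it serves both [X] and, when [q] is 0, its transpose. *)
have IHq m (q' : nat) (Z : 'M[C]_m.+1) : (m < k)%N -> (q'.+1 < m)%N -> ~~ is_scalar_mx Z ->
    exists N, mx_similar Z N /\ lower_except q'.+1 N.
  move=> lt_mk lt_qm nZ.
  have [a [c [Y [nY sZY]]]] := nonscalar_quotient (leq_ltn_trans (ltn0Sn q') lt_qm) nZ.
  have [N [sYN hN]] := IHk m q' Y lt_mk lt_qm nY.
  have [c' sYN'] := mx_similar_drblock a%:M c sYN.
  exists (block_mx a%:M 0 c' N); split; first exact: mx_similar_trans sYN'.
  rewrite -[m.+1]/(1 + m)%N => i j.
  case: (split_ordP (m := 1) (n := m) i) => i' ->;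
    case: (split_ordP (m := 1) (n := m) j) => j' ->.
  - by rewrite !ord1.
  - by rewrite block_mxEur mxE eqxx ord1.
  - by rewrite (ord1 j').
  - by rewrite block_mxEdr => ltij; rewrite hN.
case: n q X le_nk => [|[|[|n]]] // [|q] // X le_nk lt_qn nX; last exact: IHq.
  exact: nonscalar_mx2.
(* For q = 0, transposing and reversing the indices turns q into n.+1. *)
have nXt : ~~ is_scalar_mx X^T by rewrite is_scalar_mx_tr.
have [N [sXN hN]] := IHq n.+2 n X^T le_nk (ltnSn _) nXt.
exists (\matrix_(i, j) N^T (perm rev_ord_inj i) (perm rev_ord_inj j)); split.
  apply: mx_similar_trans (mx_similar_perm _ _).
  by rewrite -[X]trmxK; apply: mx_similar_tr.
move=> i j ltij; have lt_jn := ltn_ord j.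
rewrite !mxE !permE hN /=; last by lia.
by apply/andP/andP => -[/eqP ? /eqP ?]; split; apply/eqP; lia.
Qed.

(** The last condition places [N] in every strict Hessenberg space that contains [delta_mx p q]. *)
Lemma nonscalar_block_entry (C : numClosedFieldType) (n : nat) (X : 'M[C]_n)
    (p q : 'I_n) : (q < p)%N -> ~~ is_scalar_mx X ->
  exists N, [/\ mx_similar X N, N p q != 0 &
    forall i j : 'I_n, (j < i)%N -> N i j != 0 -> (q <= j)%N && (i <= p)%N].
Proof.
move=> lt_qp nX; have lt_qn : (q.+1 < n)%N := leq_ltn_trans lt_qp (ltn_ord p).
have nXt : ~~ is_scalar_mx X^T by rewrite is_scalar_mx_tr.
have [N [sXN hN]] := nonscalar_lower_except lt_qn nXt.
pose q1 := Ordinal lt_qn; pose s := tperm q1 p.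
have sp : s p = q1 by rewrite tpermR.
have sq : s q = q by rewrite tpermD // -val_eqE /= gtn_eqF.
exists (\matrix_(i, j) N^T (s i) (s j)); split.
- apply: mx_similar_trans (mx_similar_perm _ _).
  by rewrite -[X]trmxK; apply: mx_similar_tr.
- by rewrite !mxE sp sq hN /= ?eqxx.
move=> i j lt_ji; rewrite !mxE => Nij.
have [lt_s|le_s] := ltnP (s j) (s i).
  move: Nij; rewrite hN // => /andP[/eqP sj /eqP si].
  have -> : i = p by apply: (@perm_inj _ s); rewrite sp; apply: val_inj.
  have -> : j = q by apply: (@perm_inj _ s); rewrite sq; apply: val_inj.
  by rewrite !leqnn.
(* From [j < i] and [s i <= s j] it follows that both indices lie between [q.+1] and [p]. *)
move: le_s; rewrite /s; case: tpermP => [->|->|_ _]; case: tpermP => [->|->|_ _] /=; lia.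
Qed.

(** * Matrix units in strict Hessenberg spaces *)

Section StrictHessenberg.
Variables (F : fieldType) (n : nat).
Implicit Types (A b : 'M[F]_n) (H : {vspace 'M[F]_n}) (i j p q : 'I_n).

Lemma upper_triangularP A :
  upper_triangular A <-> forall i j, (j < i)%N -> A i j = 0.
Proof.
split=> [/is_trig_mxP uA i j ltji|uA]; first by have := uA j i ltji; rewrite mxE.
by apply/is_trig_mxP => i j ltij; rewrite mxE uA.
Qed.

Lemma upper_triangular_delta p q : (p <= q)%N -> upper_triangular (delta_mx p q : 'M[F]_n).
Proof.
move=> le_pq; apply/upper_triangularP => i j ltji; rewrite mxE.
by case: andP => [[/eqP ei /eqP ej]|//]; rewrite ei ej ltnNge le_pq in ltji.
Qed.

Lemma delta_mx_sandwich A p q :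
  delta_mx p p *m A *m delta_mx q q = A p q *: delta_mx p q.
Proof.
rewrite -(mul_delta_mx (0 : 'I_1) p p) -(mul_delta_mx (0 : 'I_1) q q).
rewrite -!mulmxA (mulmxA A) (mulmxA (delta_mx 0 p)) -colE -rowE.
have -> : row p (col q A) = (A p q)%:M by apply/matrixP=> i j; rewrite !ord1 !mxE.
by rewrite mul_scalar_mx -scalemxAr mul_delta_mx.
Qed.

(* Bracketing with E_pp and then E_qq leaves only the entries (p, q) and
   (q, p) of A, and E_qp is upper triangular. *)
Lemma strict_hessenberg_delta H A p q : strict_hessenberg H ->
  A \in H -> A p q != 0 -> delta_mx p q \in H.
Proof.
case=> bH adH AH Apq; have [le_pq|lt_qp] := leqP p q.
  exact/bH/upper_triangular_delta.
have ud (i : 'I_n) := upper_triangular_delta (leqnn i).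
have := adH _ _ (adH _ _ AH (ud p)) (ud q); rewrite /lie_bracket.
have nqp : q != p by rewrite -val_eqE /= ltn_eqF.
rewrite mulmxBl mulmxBr !mulmxA !delta_mx_sandwich -(mulmxA A).
have -> : delta_mx p p *m delta_mx q q = 0 :> 'M[F]_n.
  by rewrite mul_delta_mx_0 // eq_sym.
rewrite (mul_delta_mx_0 _ _ _ nqp) mulmx0 mul0mx sub0r subr0 -opprD rpredN.
rewrite rpredDr; last exact/rpredZ/bH/upper_triangular_delta/ltnW.
by rewrite rpredZeq (negPf Apq).
Qed.

(* As [E_pq, E_qj] = E_pj and [E_pj, E_ip] = - E_ij. *)
Lemma strict_hessenberg_ideal H p q i j : strict_hessenberg H ->
  delta_mx p q \in H -> (i <= p)%N -> (q <= j)%N -> delta_mx i j \in H.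
Proof.
case=> bH adH Hpq le_ip le_qj; have [le_ij|lt_ji] := leqP i j.
  exact/bH/upper_triangular_delta.
have njp : j != p by rewrite -val_eqE /= ltn_eqF // (leq_trans lt_ji).
have nji : j != i by rewrite -val_eqE /= ltn_eqF.
have := adH _ _ Hpq (upper_triangular_delta le_qj).
rewrite /lie_bracket mul_delta_mx mul_delta_mx_0 // subr0 => Hpj.
have := adH _ _ Hpj (upper_triangular_delta le_ip).
by rewrite /lie_bracket mul_delta_mx mul_delta_mx_0 // sub0r rpredN.
Qed.

Lemma mem_deltas H A :
  (forall i j, A i j != 0 -> delta_mx i j \in H) -> A \in H.
Proof.
move=> AH; rewrite [A]matrix_sum_delta; apply: memv_suml => i _.
apply: memv_suml => j _; have [->|/AH] := eqVneq (A i j) 0.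
  by rewrite scale0r mem0v.
exact: rpredZ.
Qed.

(** Only entries [A i j] with [p <= i] and [j <= q] contribute; a nonzero one would put
    [delta_mx i j], hence [delta_mx p q], into [H]. *)
Lemma upper_sandwich_entry H A b b' p q : strict_hessenberg H -> A \in H ->
    delta_mx p q \notin H -> upper_triangular b -> upper_triangular b' ->
  (b' *m A *m b) p q = 0.
Proof.
move=> hH AH nHpq /upper_triangularP ub /upper_triangularP ub'.
rewrite mxE big1 // => j _; rewrite mxE big_distrl /= big1 // => i _.
have [/ub->|le_jq] := ltnP q j; first by rewrite mulr0.
have [/ub'->|le_pi] := ltnP i p; first by rewrite !mul0r.
have [->|Aij] := eqVneq (A i j) 0; first by rewrite mulr0 mul0r.
case/negP: nHpq; apply: strict_hessenberg_ideal le_pi le_jq => //.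
exact: strict_hessenberg_delta Aij.
Qed.

End StrictHessenberg.

(** * Comparison of Hessenberg varieties *)

Lemma borel_coset_eq (F : fieldType) (n : nat) (g g' : 'M[F]_n) :
    borel_coset g = borel_coset g' -> exists2 b, upper_triangular b & g = g' *m b.
Proof.
have id_borel : borel_group (1%:M : 'M[F]_n).
  split; first exact: unitmx1.
  by apply/upper_triangularP => i j ltji; rewrite mxE -val_eqE /= gtn_eqF.
move=> eg; have : borel_coset g' g by rewrite -eg; exists 1%:M; rewrite ?mulmx1.
by case=> b [_ ub] <-; exists b.
Qed.

(** Treating one inclusion at a time lets the theorem follow by symmetry. *)
Lemma Hess_subset_hessenberg (C : numClosedFieldType) (n : nat) (X : 'M[C]_n)
    (H1 H2 : {vspace 'M[C]_n}) : ~~ is_scalar_mx X ->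
    strict_hessenberg H1 -> strict_hessenberg H2 ->
  (Hess X H1 `<=` Hess X H2)%classic -> (H1 <= H2)%VS.
Proof.
move=> nX hH1 hH2 sub; apply/subvP => A AH1; apply: mem_deltas => p q Apq.
have H1pq := strict_hessenberg_delta hH1 AH1 Apq.
have [le_pq|lt_qp] := leqP p q; first exact/hH2.1/upper_triangular_delta.
apply: contraT => nH2pq.
have [N [[G uG GX] Npq hN]] := nonscalar_block_entry lt_qp nX.
have NH1 : N \in H1.
  apply: mem_deltas => i j Nij; have [le_ij|lt_ji] := leqP i j.
    exact/hH1.1/upper_triangular_delta.
  by have /andP[] := hN _ _ lt_ji Nij; move=> *; apply: strict_hessenberg_ideal H1pq _ _.
have : Hess X H1 (borel_coset (invmx G)).
  exists (invmx G) => //; split; first by rewrite /GLset /= unitmx_inv.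
  by rewrite invmxK GX mulmxK.
case/sub => g [ug gH2] eg.
(* Reading the coset equality in both directions shows that [G *m g] and its inverse are both upper
   triangular. *)
have [b ub gb] := borel_coset_eq eg; have [b' ub' gb'] := borel_coset_eq (esym eg).
suff eN : N = b *m (invmx g *m X *m g) *m b'.
  by rewrite eN (upper_sandwich_entry hH2 gH2 nH2pq) ?eqxx in Npq.
have -> : b = G *m g by rewrite gb mulKVmx.
have -> : b' = invmx g *m invmx G by rewrite gb' mulKmx.
by rewrite !mulmxA mulmxK // mulmxK // GX mulmxK.
Qed.

Theorem theorem14 (R : realType) (n : nat) (hn : (1 <= n)%N)
    (X : 'M[R[i]]_n) (hX : forall a : R[i], X <> a%:M)
    (H1 H2 : {vspace 'M[R[i]]_n})
    (hH1 : strict_hessenberg H1) (hH2 : strict_hessenberg H2)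
    (hH : H1 <> H2) :
  Hess X H1 <> Hess X H2.
Proof.
have nX : ~~ is_scalar_mx X by apply/negP => /is_scalar_mxP[a /hX].
move=> eH; apply: hH; apply/eqP; rewrite eqEsubv.
by rewrite !(Hess_subset_hessenberg nX) // eH.
Qed.
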